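(* Let $(N,G)$ be a nearly ordered permutation group having a nonidentity bounded element, and suppose $N$ is Dedekind complete. The following are equivalent: (1) $(N,G)$ is highly approximately $o$-transitive; (2) $(N,G)$ is approximately 2-upward-transitive (in the linear/monotonic case), respectively approximately 3-outward-transitive (in the circular/monocircular case); (3) $(N,G)$ is locally sweeping.
   Context: Let $L$ be a dense linear order. A nearly ordered permutation group $(N,G)$, $G\le\mathrm{Aut}(N)$, is linear ($N=(L,<)$, $L$ without endpoints, order-preserving bijections), monotonic ($N=\mathrm{ED}(L)$, $L$ without endpoints, order-preserving or order-reversing bijections of $L$), circular ($N=C=(L,\mathrm{Cr})$, $L$ with at most one endpoint, $\mathrm{Cr}(x,y,z)$ iff $x<y<z$ or $y<z<x$ or $z<x<y$, $\mathrm{Cr}$-preserving bijections) or monocircular (bijections preserving or reversing $\mathrm{Cr}$). $N$ is Dedekind complete if it equals its Dedekind completion (in the circular case: the underlying order completed, with one endpoint adjoined if none). $\mathrm{Opp}(G)$ is the subgroup of order- (orientation-) preserving elements. $\mathrm{supp}(g)=\{x:g(x)\ne x\}$; $g$ is bounded if its support lies in a bounded interval: $(x,y)$, $x<y$ (linear/monotonic) or $(x,y)=\{z:\mathrm{Cr}(x,z,y)\}$, $x\ne y$ (circular). Approximately $n$-$o$-transitive: for $a_1<\dots<a_n$ in $L$ and intervals $I_1<\dots<I_n$ (circular: $\mathrm{Cr}(a_i,a_j,a_k)$ for $i<j<k$ and the analogous condition $\mathrm{Crs}$ on the intervals, with $n=2$ meaning distinct/disjoint), some $g\in G$ has $g(a_k)\in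 I_k$ for all $k$; highly = for all $n$. Approximately 2-upward-transitive: for any $a<b<c$ in $L$ and any interval $I\ni a$ there is $g\in\mathrm{Opp}(G)$ with $g(a)\in I$ and $g(b)>c$. Approximately 3-outward-transitive: for any $a\in C$, $b,c\in C$ with $\mathrm{Cr}(b,a,c)$, and bounded intervals $I\subseteq J$ with $a\in I$, there is $g\in G$ with $g(a)\in I$ and $g(b),g(c)\notin J$. Locally sweeping: for every bounded interval $I$ and every $a\in I$ there is $g\in G$ with $\mathrm{supp}(g)\subseteq I$ and $g(a)\ne a$. *)

(* Defs.v *)
From mathcomp Require Import all_boot all_order.
From mathcomp Require Import boolp classical_sets.

Set Implicit Arguments.
Unset Strict Implicit.
Unset Printing Implicit Defensive.

Import Order.TTheory.
Local Open Scope order_scope.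
Local Open Scope classical_set_scope.

Inductive kind := Linear | Monotonic | Circular | Monocircular.

Definition is_circ (k : kind) : bool :=
  match k with Linear | Monotonic => false | Circular | Monocircular => true end.

Section NearlyOrdered.
Context {d : Order.disp_t} {L : orderType d}.
Implicit Types (k : kind) (G : set (L -> L)) (f g : L -> L) (A I J : set L).

Definition dense_order : Prop :=
  forall x y : L, x < y -> exists z : L, x < z /\ z < y.

Definition endpoint (x : L) : Prop :=
  (forall y, x <= y) \/ (forall y, y <= x).

Definition nearly_ordered k : Prop :=
  dense_order /\
  (if is_circ k then forall x y : L, endpoint x -> endpoint y -> x = y
   else forall x : L, ~ endpoint x).

Definition Cr (x y z : L) : bool :=
  [|| (x < y) && (y < z), (y < z) && (z < x) | (z < x) && (x < y)].

Definition preserving k f : Prop :=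
  if is_circ k then forall x y z, Cr (f x) (f y) (f z) = Cr x y z
  else forall x y, (f x < f y) = (x < y).

Definition reversing k f : Prop :=
  if is_circ k then forall x y z, Cr (f x) (f y) (f z) = Cr z y x
  else forall x y, (f x < f y) = (y < x).

Definition Aut k : set (L -> L) :=
  [set f | bijective f /\
    match k with
    | Linear | Circular => preserving k f
    | Monotonic | Monocircular => preserving k f \/ reversing k f
    end].

Definition perm_group G : Prop :=
  [/\ G id,
      forall f g, G f -> G g -> G (f \o g)
    & forall f, G f -> exists2 g, G g & cancel f g /\ cancel g f].

Definition nearly_ordered_perm_group k G : Prop :=
  [/\ nearly_ordered k, perm_group G & G `<=` Aut k].

Definition Opp k G : set (L -> L) := G `&` preserving k.

(* The Dedekind completion of [L] (not adding endpoints) is modelled by the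
   nonempty bounded-above normal lower sets, [x : L] being identified with
   [lower_ray x].  Unlike the sets [set y | y < x], these also represent an
   endpoint of [L] correctly. *)
Definition lower_ray (x : L) : set L := [set y | y <= x].

Definition dedekind_completion : set (set L) :=
  [set A | [/\ A !=set0, ubound A !=set0 & lbound (ubound A) = A]].

(* In the circular case, [setT] stands for the endpoint adjoined (as a last
   element) when [L] has none. *)
Definition completion k : set (set L) :=
  if is_circ k then
    dedekind_completion `|`
      [set A | A = setT /\ forall x : L, ~ endpoint x]
  else dedekind_completion.

Definition dedekind_complete k : Prop := completion k = range lower_ray.

Definition bounded_interval k : set (set L) :=
  if is_circ k then
    [set I | exists x y : L, x != y /\ I = [set z | Cr x z y]]
  else
    [set I | exists x y : L, x < y /\ I = [set z | x < z /\ z < y]].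

(* Intervals are open and nonempty, and may be unbounded: rays and [L] itself;
   on a circle, the complement of a point and the circle itself. *)
Definition open_interval k : set (set L) :=
  bounded_interval k `|`
  (if is_circ k then
     [set I | I = setT \/ exists x : L, I = [set z | z != x]]
   else
     [set I | [\/ I = setT,
                  exists x : L, I = [set z | x < z]
                | exists x : L, I = [set z | z < x]]]).

Definition supp g : set L := [set x | g x <> x].

Definition bounded_perm k g : Prop :=
  exists2 I, bounded_interval k I & supp g `<=` I.

(* In the circular case pairwise distinctness (resp. disjointness) follows from
   the condition on triples as soon as [n >= 3]; it is the whole condition when
   [n = 2]. *)
Definition ordered_points k n (a : 'I_n -> L) : Prop :=
  if is_circ k then
    (forall i j : 'I_n, (i < j)%N -> a i <> a j) /\
    (forall i j l : 'I_n, (i < j)%N -> (j < l)%N -> Cr (a i) (a j) (a l))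
  else forall i j : 'I_n, (i < j)%N -> a i < a j.

Definition ordered_sets k n (I : 'I_n -> set L) : Prop :=
  if is_circ k then
    (forall i j : 'I_n, (i < j)%N -> I i `&` I j = set0) /\
    (forall i j l : 'I_n, (i < j)%N -> (j < l)%N ->
       forall x y z, I i x -> I j y -> I l z -> Cr x y z)
  else forall i j : 'I_n, (i < j)%N -> forall x y, I i x -> I j y -> x < y.

Definition approx_o_transitive k n G : Prop :=
  forall (a : 'I_n -> L) (I : 'I_n -> set L),
    ordered_points k a ->
    (forall i, open_interval k (I i)) -> ordered_sets k I ->
    exists2 g, G g & forall i, I i (g (a i)).

Definition highly_approx_o_transitive k G : Prop :=
  forall n, approx_o_transitive k n G.

Definition approx_2_upward_transitive k G : Prop :=
  forall (a b c : L) I, a < b -> b < c -> open_interval k I -> I a ->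
    exists2 g, Opp k G g & I (g a) /\ c < g b.

Definition approx_3_outward_transitive k G : Prop :=
  forall (a b c : L) I J, Cr b a c ->
    bounded_interval k I -> bounded_interval k J -> I `<=` J -> I a ->
    exists2 g, G g & [/\ I (g a), ~ J (g b) & ~ J (g c)].

Definition locally_sweeping k G : Prop :=
  forall I (a : L), bounded_interval k I -> I a ->
    exists2 g, G g & supp g `<=` I /\ g a <> a.

End NearlyOrdered.

Arguments dedekind_complete {d} L k.

(* Main.v *)
Require Import Defs.
From mathcomp Require Import all_boot all_order zify.
From mathcomp Require Import boolp classical_sets.

(* Highly approximate o-transitivity trivially gives the stretching property.

   Sweeping to transitive: if the orbit of a point under the elements supported
   in an arc (x, y) had a supremum inside the arc, some such element would move
   that supremum upwards; so orbits are cofinal in the arc.  Points of an arc are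
   then put in place one at a time, starting with the last one; a circle is cut
   at the first point once that point is in place.

   Stretching to sweeping, circular case: conjugate the given bounded element by
   g with g a in its support and the ends of the target arc sent off its support.

   Stretching to sweeping, linear case: call w stuck over z when all bounded
   elements supported in (z, oo) fix w.  A conjugate of the bounded element fixes
   some s above z and moves w, so at least two points are stuck over s, hence
   there is a gap (sg, ta) between such points; an element e with e sg in the gap
   and ta < e ta is then contradictory, whether e s <= s or s < e s.  So nothing
   is stuck.  If all elements supported in (p, q) fixed b, let Q be the supremum
   of the q with this property; some element supported in (b, oo) moves Q up,
   although conjugating by it preserves the property. *)

Set Implicit Arguments.
Unset Strict Implicit.
Unset Printing Implicit Defensive.

Import Order.TTheory.
Local Open Scope order_scope.
Local Open Scope classical_set_scope.

(** * Arcs of the cyclic order *)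

(** The rank of a point is the number of entries of [s] below it; finite configurations thus become
    configurations in [nat], where [lia] applies. *)
Lemma rank_embedding d (L : orderType d) (s : seq L) :
  exists f : L -> nat, {in s &, forall x y, (x < y) = (f x < f y)%N}.
Proof.
exists (fun x => count (fun z => z < x) s).
have mono (x y : L) : x \in s -> x < y ->
    (count (fun z => (z < x)%O) s < count (fun z => (z < y)%O) s)%N.
  move=> xs xy.
  have := count_predUI (fun z => (z < x)%O) (pred1 x) s.
  rewrite (@eq_count _ (predI _ _) pred0) => [|z /=]; last first.
    by case: eqP => [->|]; rewrite ?ltxx ?andbF.
  rewrite count_pred0 addn0 => E.
  apply: (@leq_trans (count (predU (fun z => (z < x)%O) (pred1 x)) s)).
    by rewrite E -addn1 leq_add2l -has_count has_pred1.
  by apply: sub_count => z /= /orP[/lt_trans->//|/eqP->].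
move=> x y xs ys /=; case: (ltgtP x y) => [xy|yx|->]; last by rewrite ltnn.
- by rewrite mono.
- by rewrite ltnNge ltnW // mono.
Qed.

(* Decides statements about [Cr], [<] and [==] on the points of [s] by
   transporting them to [nat]. *)
Ltac cyc s :=
  let f := fresh "f" in let Ef := fresh "Ef" in
  let El := fresh "El" in let Ee := fresh "Ee" in
  case: (rank_embedding s) => f Ef;
  (have El : forall x y, x \in s -> y \in s -> (x < y) = (f x < f y)%N
    by exact: Ef);
  (have Ee : forall x y, x \in s -> y \in s -> (x == y) = (f x == f y)
    by (move=> ? ? ? ?; rewrite eq_le !leNgt !El //; lia));
  clear Ef; rewrite /Cr ?El ?Ee; rewrite ?inE ?eqxx ?orbT //; clear -f; lia.

(* Rotating the ranks so that [x] comes first turns [Cr x u v] into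
   [0 < f u < f v]. *)
Lemma cyclic_rank_embedding d (L : orderType d) (x : L) (s : seq L) :
  exists f : L -> nat, [/\ f x = 0%N,
    forall u v, u \in x :: s -> v \in x :: s -> (u == v) = (f u == f v) &
    forall u v w, u \in x :: s -> v \in x :: s -> w \in x :: s ->
      Cr u v w = [|| (f u < f v)%N && (f v < f w)%N,
        (f v < f w)%N && (f w < f u)%N | (f w < f u)%N && (f u < f v)%N]].
Proof.
have [f Ef] := rank_embedding (x :: s).
pose N := \max_(u <- x :: s) f u.
have fN u : u \in x :: s -> (f u <= N)%N by move=> us; exact: leq_bigmax_seq.
have El u v : u \in x :: s -> v \in x :: s -> (u < v) = (f u < f v)%N by exact: Ef.
have Ee u v : u \in x :: s -> v \in x :: s -> (u == v) = (f u == f v).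
  by move=> us vs; rewrite eq_le !leNgt !El //; lia.
have xs : x \in x :: s by rewrite mem_head.
exists (fun u => if (f u < f x)%N then (N + 1 + f u)%N else (f u - f x)%N).
split=> [|u v us vs|u v w us vs ws]; first by rewrite ltnn subnn.
- by rewrite Ee //; have := fN u us; have := fN v vs; have := fN x xs;
    do 2?case: ifP; lia.
- rewrite /Cr !El //; have := fN u us; have := fN v vs; have := fN w ws.
  by have := fN x xs; do 3?case: ifP; lia.
Qed.

(** Variant of [cyc] for goals in [Cr] and [==] only, with [x] as base point of rank 0. *)
Ltac cycb x s :=
  let f := fresh "f" in let f0 := fresh "f0" in
  let Ec := fresh "Ec" in let Ee := fresh "Ee" in
  case: (cyclic_rank_embedding x s) => f [f0 Ee Ec];
  rewrite ?Ec ?Ee; rewrite ?inE ?eqxx ?orbT // ?f0; clear -f; lia.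

(** For [x < y] this is the ordinary open interval, for [y < x] it wraps around; the same arguments
    then cover lines and circles. *)
Definition open_arc d (L : orderType d) (x y : L) : set L := [set z | Cr x z y].

Definition proper_arc d (L : orderType d) (k : kind) (x y : L) : bool :=
  if is_circ k then x != y else x < y.

Section Arcs.
Context {d : Order.disp_t} {L : orderType d} (k : kind).
Implicit Types (x y z u v w : L) (S : set L).

Lemma CrE x y z : x < y -> Cr x z y = (x < z) && (z < y).
Proof. cyc [:: x; y; z]. Qed.

(** An arc that avoids [p] and [q] lies entirely on one side of them. *)
Lemma Cr_same_side x y u v p q :
  Cr x u y -> Cr x v y -> ~~ Cr x p y -> ~~ Cr x q y -> Cr p u q -> Cr p v q.
Proof. cyc [:: x; y; u; v; p; q]. Qed.

Lemma bounded_intervalE (I : set L) : bounded_interval k I <->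
  exists x y, proper_arc k x y /\ I = open_arc x y.
Proof.
rewrite /bounded_interval /proper_arc; case: ifP => _ //.
have E x y : x < y -> [set z | x < z /\ z < y] = open_arc x y.
  by move=> xy; apply/seteqP; split=> z; rewrite /open_arc /= CrE // => /andP.
by split=> -[x [y [xy ->]]]; exists x, y; rewrite E.
Qed.

Lemma proper_arcl x y z : proper_arc k x y -> Cr x z y -> proper_arc k x z.
Proof. by rewrite /proper_arc; case: ifP => _; cyc [:: x; y; z]. Qed.

Lemma proper_arcr x y z : proper_arc k x y -> Cr x z y -> proper_arc k z y.
Proof. by rewrite /proper_arc; case: ifP => _; cyc [:: x; y; z]. Qed.

Lemma preserving_Cr (f : L -> L) :
  preserving k f -> forall x y z, Cr (f x) (f y) (f z) = Cr x y z.
Proof. by rewrite /preserving; case: ifP => // _ fE x y z; rewrite /Cr !fE. Qed.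

Context (kL : nearly_ordered (L := L) k).

Lemma arc_nonempty x y : proper_arc k x y -> exists z, Cr x z y.
Proof.
case: kL; rewrite /proper_arc => dense; case: ifP => [_ ends xy|_ _ xy]; last first.
  by have [z [xz zy]] := dense _ _ xy; exists z; move: xz zy; cyc [:: x; y; z].
have [lt_xy|lt_yx|/eqP] := ltgtP x y; last by rewrite (negPf xy).
  by have [z [xz zy]] := dense _ _ lt_xy; exists z; move: xz zy; cyc [:: x; y; z].
have [[z xz]|xmax] := pselect (exists z, x < z).
  by exists z; move: xz lt_yx; cyc [:: x; y; z].
have [[z zy]|ymin] := pselect (exists z, z < y).
  by exists z; move: zy lt_yx; cyc [:: x; y; z].
(* With nothing above [x] and nothing below [y], both are endpoints, hence equal. *)
case/eqP: xy; apply: ends.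
  by right=> z; rewrite leNgt; apply/negP => xz; apply: xmax; exists z.
by left=> z; rewrite leNgt; apply/negP => zy; apply: ymin; exists z.
Qed.

Context (complete : dedekind_complete L k).

(** The normal lower set generated by [S] lies in the completion, hence is a lower ray; its top is
    the supremum. *)
Lemma lub_exists S : S !=set0 -> ubound S !=set0 ->
  exists2 s, ubound S s & forall u, ubound S u -> s <= u.
Proof.
move=> [a Sa] [b Sb].
have SB : S `<=` lbound (ubound S) by move=> z Sz u; apply.
have : completion k (lbound (ubound S)).
  have DB : dedekind_completion (lbound (ubound S)).
    split; first by exists a; exact: SB.
      by exists b => z; apply.
    apply/seteqP; split; last by move=> z Bz u; apply.
    by move=> z zB u Su; apply: zB => v; apply.
  by rewrite /completion; case: ifP => // _; left.
rewrite complete => -[s _ sE]; exists s.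
  by move=> z /SB; rewrite -sE.
have : lower_ray s s by rewrite /lower_ray /=.
by rewrite sE => sB u /sB.
Qed.

(** [Cr x] orders the arc as read from [x]; [s] is the least upper bound of [S] for that order, the
    far end [y] being allowed. *)
Lemma arc_sup x y S : proper_arc k x y -> S `<=` open_arc x y -> S !=set0 ->
  exists s, [/\ s = y \/ Cr x s y, forall z, S z -> z = s \/ Cr x z s
    & forall v, Cr x v s -> exists2 z, S z & Cr x v z].
Proof.
(* For a wrapping arc, [S] has a supremum on the side of [y] as soon as it
   reaches that side. *)
have sup (T : set L) b : T `<=` S -> (forall z, T z -> z <= b) -> T !=set0 ->
    exists s, [/\ forall z, T z -> z <= s,
      (forall v, v < s -> exists2 z, T z & v < z), s <= b & exists2 z, T z & z <= s].
  move=> TS Tb T0; have [|s sub smin] := lub_exists T0; first by exists b.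
  exists s; split=> //; last by case: T0 => z Tz; exists z => //; apply: sub.
    move=> v vs; apply: contrapT => N.
    have /smin : ubound T v.
      by move=> z Tz; rewrite leNgt; apply/negP=> vz; apply: N; exists z.
    by rewrite leNgt vs.
  exact: smin.
move=> xy Sxy S0.
have ne : x != y by move: xy; rewrite /proper_arc; case: ifP => // _; cyc [:: x; y].
have [lt_xy|lt_yx|/eqP] := ltgtP x y; last by rewrite (negPf ne).
- have [//||//|s [sub slub sy [z0 Sz0 z0s]]] := sup S y.
    by move=> z /Sxy; rewrite /open_arc /= CrE // => /andP[_ /ltW].
  exists s; move: (Sxy _ Sz0); rewrite /open_arc /= CrE // => /andP[xz0 z0y].
  have xs := lt_le_trans xz0 z0s.
  split.
  + by move: sy xs; rewrite le_eqVlt => /orP[/eqP|]; [left|right; rewrite CrE ?xs].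
  + move=> z Sz; have := sub _ Sz; rewrite le_eqVlt => /orP[/eqP|zs]; first by left.
    right; move: (Sxy _ Sz) zs; rewrite /open_arc /=; move: lt_xy xs sy.
    by rewrite [s <= y]leNgt; cyc [:: x; y; z; s].
  + move=> v xvs; have [z Sz vz] : exists2 z, S z & v < z.
      by apply: slub; move: xvs xs; cyc [:: x; v; s].
    by exists z => //; move: xvs vz xs; cyc [:: x; v; s; z].
have [S1|S1] := pselect (exists z, S z /\ z < x).
- have [||//|s [sub slub sy [z0 [Sz0 /= z0x] z0s]]] := sup (S `&` [set z | z < x]) y.
  + by move=> z [].
  + move=> z [/Sxy + /= zx]; rewrite leNgt /open_arc /=; move: zx lt_yx.
    by cyc [:: x; y; z].
  have sx := le_lt_trans sy lt_yx.
  exists s; split.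
  + move: sy; rewrite le_eqVlt => /orP[/eqP|sy]; first by left.
    by right; move: sy lt_yx; cyc [:: x; y; s].
  + move=> z Sz; have [zx|xz] := ltP z x.
      have := sub z (conj Sz zx); rewrite le_eqVlt => /orP[/eqP|zs]; first by left.
      by right; move: zs sx; cyc [:: x; z; s].
    right; move: (Sxy _ Sz) sx xz; rewrite /open_arc /= [x <= z]leNgt.
    by cyc [:: x; y; z; s].
  + move=> v xvs; have [vs|sv] := ltP v s.
      have [z [Sz /= zx] vz] := slub _ vs; exists z => //.
      by move: xvs vz zx; cyc [:: x; v; s; z].
    exists z0 => //; move: xvs sv z0x sx z0s; rewrite [s <= v]leNgt [z0 <= s]leNgt.
    by cyc [:: x; v; s; z0].
have Sgt z : S z -> x < z.
  move=> Sz; have := Sxy _ Sz; rewrite /open_arc /=.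
  have : ~~ (z < x) by apply/negP => zx; apply: S1; exists z.
  by cyc [:: x; y; z].
have [[b Sb]|unb] := pselect (exists b, forall z, S z -> z <= b).
- have [//|//|//|s [sub slub sb [z0 Sz0 z0s]]] := sup S b.
  have xs := lt_le_trans (Sgt _ Sz0) z0s.
  exists s; split.
  + by right; move: xs lt_yx; cyc [:: x; y; s].
  + move=> z Sz; have := sub _ Sz; rewrite le_eqVlt => /orP[/eqP|zs]; first by left.
    by right; move: zs (Sgt _ Sz); cyc [:: x; z; s].
  + move=> v xvs; have [z Sz vz] : exists2 z, S z & v < z.
      by apply: slub; move: xvs xs; cyc [:: x; v; s].
    by exists z => //; move: xvs vz xs; cyc [:: x; v; s; z].
(* Otherwise [S] is cofinal in [L], whose endpoint is then its least element. *)
have circ : is_circ k.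
  by move: xy; rewrite /proper_arc; case: is_circ => //; move: lt_yx; cyc [:: x; y].
(* Without endpoints, [setT] would be in the completion and thus a lower ray, whose top would be an
   endpoint. *)
have [e [emin|emax]] : exists e : L, endpoint e.
  apply: contrapT => N.
  have : completion k (setT : set L).
    by rewrite /completion circ; right; split=> // z ez; apply: N; exists z.
  rewrite complete => -[e _ eE]; apply: N; exists e; right=> z.
  by have : setT z by []; rewrite -eE.
(* Read from [x], the least element comes immediately after all points above [x]. *)
- exists e; split.
  + have := emin y; rewrite le_eqVlt => /orP[/eqP|ey]; first by left.
    by right; move: ey lt_yx; cyc [:: x; y; e].
  + move=> z /Sgt xz; right; have := emin y; move: xz lt_yx.
    by rewrite [e <= y]leNgt; cyc [:: x; y; e; z].
  + move=> v xve; have xv : x < v.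
      have := emin y; have := emin v; move: xve lt_yx.
      by rewrite ![e <= _]leNgt; cyc [:: x; y; e; v].
    apply: contrapT => N; apply: unb; exists v => z Sz; rewrite leNgt.
    by apply/negP => vz; apply: N; exists z => //; move: xv vz; cyc [:: x; v; z].
- by case: unb; exists e.
Qed.

End Arcs.

(** * Rigid stabilizers and their conjugates *)

Definition rigid_stab d (L : orderType d) (G : set (L -> L)) (A : set L) :
  set (L -> L) := [set g | G g /\ supp g `<=` A].

Section RigidStabilizers.
Context {d : Order.disp_t} {L : orderType d} (G : set (L -> L)).
Implicit Types (A B : set L) (g h : L -> L).

Lemma rigid_stab_fix A g z : rigid_stab G A g -> ~ A z -> g z = z.
Proof. by move=> [_ gA] Az; apply: contrapT => /gA. Qed.

Lemma rigid_stabS A B g : A `<=` B -> rigid_stab G A g -> rigid_stab G B g.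
Proof. by move=> AB [Gg gA]; split=> // z /gA /AB. Qed.

Context (G1 : G id) (GM : forall f g, G f -> G g -> G (f \o g))
  (GV : forall f, G f -> exists2 g, G g & cancel f g /\ cancel g f).

Lemma rigid_stab1 A : rigid_stab G A id.
Proof. by split=> // z /(_ erefl). Qed.

Lemma rigid_stabM A f g :
  rigid_stab G A f -> rigid_stab G A g -> rigid_stab G A (f \o g).
Proof.
move=> fA gA; split=> [|z /=]; first by case: fA gA => Gf _ [Gg _]; apply: GM.
have [//|nAz] := pselect (A z).
by rewrite /supp /= (rigid_stab_fix gA nAz) (rigid_stab_fix fA nAz).
Qed.

Lemma rigid_stabV A f : rigid_stab G A f ->
  exists g, [/\ rigid_stab G A g, cancel f g & cancel g f].
Proof.
move=> [Gf fA]; have [g Gg [fK gK]] := GV Gf; exists g; split=> //.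
split=> // z /= gz; apply: fA => /= fz; apply: gz.
by rewrite -{1}fz fK.
Qed.

(** Conjugation by [f] carries supports along [f]; the image of [A] appears as its preimage under
    the inverse [f']. *)
Lemma rigid_stabJ A f f' h : G f -> G f' -> cancel f f' -> cancel f' f ->
  rigid_stab G A h -> rigid_stab G (f' @^-1` A) (f \o h \o f').
Proof.
move=> Gf Gf' fK f'K [Gh hA]; split; first by do 2?[apply: GM].
by move=> z Jz; apply: hA => hz; apply: Jz; rewrite /= hz f'K.
Qed.

End RigidStabilizers.

(** * From local sweeping to transitivity *)

Section LocallySweeping.
Context {d : Order.disp_t} {L : orderType d} (k : kind) (G : set (L -> L)).
Context (HG : nearly_ordered_perm_group k G).
Implicit Types (x y z u v w : L) (g h : L -> L).

Lemma preserving_or_reversing g : G g -> preserving k g \/ reversing k g.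
Proof.
by have [_ _ GA] := HG => /GA[_]; case: (k) => // ?; left.
Qed.

Lemma rigid_stab_arc_ends x y g :
  rigid_stab G (open_arc x y) g -> g x = x /\ g y = y.
Proof.
move=> gxy; split; apply: (rigid_stab_fix gxy); rewrite /open_arc /=; apply/negP.
  by cycb x [:: y].
by cycb x [:: y].
Qed.

(** A reversing map cannot fix both ends on a line, nor, on a circle, both ends and a third point
    chosen outside the arc. *)
Lemma rigid_stab_arc_preserving x y g :
  proper_arc k x y -> rigid_stab G (open_arc x y) g -> preserving k g.
Proof.
have [kL _ _] := HG => xy gxy.
have [//|] := preserving_or_reversing gxy.1.
have [fx fy] := rigid_stab_arc_ends gxy.
have := xy; rewrite /reversing /proper_arc.
case: ifP => kc ne rev; exfalso; last first.
  by have := rev x y; rewrite fx fy ne; move: ne; cyc [:: x; y].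
have yx : proper_arc k y x by rewrite /proper_arc kc eq_sym.
have [z yzx] := arc_nonempty kL yx.
have fz : g z = z.
  apply: (rigid_stab_fix gxy); rewrite /open_arc /=; apply/negP.
  by move: yzx; cycb x [:: y; z].
by have := rev x y z; rewrite fx fy fz; move: yzx; cycb x [:: y; z].
Qed.

Lemma rigid_stab_arc_Cr x y g : proper_arc k x y -> rigid_stab G (open_arc x y) g ->
  forall u v w, Cr (g u) (g v) (g w) = Cr u v w.
Proof.
by move=> xy gxy; exact: preserving_Cr (rigid_stab_arc_preserving xy gxy).
Qed.

Lemma rigid_stab_arc_stable x y z g : proper_arc k x y ->
  rigid_stab G (open_arc x y) g -> Cr x z y -> Cr x (g z) y.
Proof.
move=> xy gxy; have [fx fy] := rigid_stab_arc_ends gxy.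
by rewrite -(rigid_stab_arc_Cr xy gxy) fx fy.
Qed.

Lemma rigid_stab_arc_mono x y u v g : proper_arc k x y ->
  rigid_stab G (open_arc x y) g -> Cr x (g u) (g v) = Cr x u v.
Proof.
move=> xy gxy; have [fx _] := rigid_stab_arc_ends gxy.
by rewrite -[in LHS]fx (rigid_stab_arc_Cr xy gxy).
Qed.

Context (complete : dedekind_complete L k) (sweep : locally_sweeping k G).

Lemma arc_push x y v a : proper_arc k x y -> Cr x v y -> Cr x a y ->
  exists2 g, rigid_stab G (open_arc x y) g & Cr x a (g v).
Proof.
move=> xy xvy xay; case: (HG) => kL [G1 GM GV] _.
pose S := [set z | exists2 g, rigid_stab G (open_arc x y) g & z = g v].
have [||s [sy Ss sS]] := arc_sup complete xy (S := S).
- by move=> z [g gxy ->]; exact: rigid_stab_arc_stable.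
- by exists v, id => //; exact: rigid_stab1.
have [sE|xsy] := sy.
  by have [|z [g gxy ->] xaz] := sS a; [rewrite sE|exists g].
have [g0 Gg0 [g0xy g0s]] : exists2 g, G g & supp g `<=` open_arc x y /\ g s <> s.
  by apply: sweep => //; apply/(bounded_intervalE k); exists x, y.
(* No such element can move [s] forward: its inverse would take [s] before some orbit point [z], and
   [g z] would be an orbit point beyond [s]. *)
suff [g gxy xsg] : exists2 g, rigid_stab G (open_arc x y) g & Cr x s (g s).
  have [g' [g'xy gK g'K]] := rigid_stabV GV gxy.
  have [z Sz xz] : exists2 z, S z & Cr x (g' s) z.
    by apply: sS; rewrite -(rigid_stab_arc_mono _ _ xy gxy) g'K.
  have Sgz : S (g z).
    by case: Sz => h hxy ->; exists (g \o h) => //; apply: rigid_stabM.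
  exfalso; move: xz; rewrite -(rigid_stab_arc_mono _ _ xy gxy) g'K.
  by case: (Ss _ Sgz) => [->|]; [cycb x [:: s]|cycb x [:: s; g z]].
have g0S : rigid_stab G (open_arc x y) g0 by [].
have := rigid_stab_arc_stable xy g0S xsy; have : g0 s != s by apply/eqP.
(* Either [g0] or its inverse moves [s] forward. *)
have [xsg _ _|nxsg gs xgs] := boolP (Cr x s (g0 s)); first by exists g0.
have {nxsg}gsx : Cr x (g0 s) s by move: nxsg gs xgs xsy; cycb x [:: y; s; g0 s].
have [g' [g'xy gK g'K]] := rigid_stabV GV g0S; exists g' => //.
by rewrite -(rigid_stab_arc_mono _ _ xy g0S) g'K.
Qed.

(** Inverse of a push: if [g] takes a point [m] before [q] beyond [a], its inverse takes [a] before
    [m]. *)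
Lemma arc_pull x y a p q : proper_arc k x y -> Cr x a y ->
    x = p \/ Cr x p y -> Cr p q y -> Cr p a y ->
  exists2 g, rigid_stab G (open_arc p y) g & Cr p (g a) q.
Proof.
move=> xy xay xp pqy pay; case: (HG) => kL [G1 GM GV] _.
have py : proper_arc k p y by case: xp => [<-//|]; exact: proper_arcr.
have [m pmq] := arc_nonempty kL (proper_arcl py pqy).
have [||g gpy pag] := @arc_push p y m a py.
- by move: pmq pqy; cycb p [:: q; m; y].
- by [].
have [g' [g'py gK g'K]] := rigid_stabV GV gpy; exists g' => //.
have : Cr p (g' a) m by rewrite -(rigid_stab_arc_mono _ _ py gpy) g'K.
by move: pmq; cycb p [:: q; m; g' a].
Qed.

(** Induction on [n]: the last point is parked far away at [c], the others are placed inside the arc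
    from [x] to [c], and [c] is finally pulled back into its target. *)
Lemma arc_transitive n x y (a p q : nat -> L) : proper_arc k x y ->
    (forall i, (i < n)%N -> [/\ Cr x (a i) y, Cr x (p i) (q i) & Cr x (q i) y]) ->
    (forall i j, (i < j < n)%N -> Cr x (a i) (a j) /\ Cr x (q i) (p j)) ->
  exists2 g, rigid_stab G (open_arc x y) g &
    forall i, (i < n)%N -> Cr (p i) (g (a i)) (q i).
Proof.
case: (HG) => kL [G1 GM GV] _.
elim: n y => [|n IH] y xy ends ord; first by exists id => //; exact: rigid_stab1.
have [xay xpq xqy] := ends n (ltnSn n).
(* Pushing [a n] past [M] leaves room before it for all earlier points and targets. *)
have [M [aM qM xMy]] : exists M, [/\ Cr x (a n) M, Cr x (q n) M & Cr x M y].
  have [aq|aq] := boolP (Cr x (a n) (q n)).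
    have [M M1] := arc_nonempty kL (proper_arcr xy xqy); exists M.
    by split; move: M1 xqy aq; cycb x [:: a n; q n; y; M].
  have [M M1] := arc_nonempty kL (proper_arcr xy xay); exists M.
  by split; move: M1 xqy xay aq; cycb x [:: a n; q n; y; M].
(* [l] is the point preceding [a n], or [x] if there is none; a push supported between [l] and [y]
   keeps the earlier points fixed. *)
have [l [lx la lai]] : exists l, [/\ l = x \/ Cr x l y, Cr l (a n) y
    & forall i, (i < n)%N -> ~~ Cr l (a i) y].
  case: n ends ord {IH xpq xqy qM} xay aM => [|n'] ends ord xay aM.
    by exists x; split=> //; left.
  have [xay' _ _] := ends n' (ltnW (ltnSn n'.+1)).
  have [xaa _] : Cr x (a n') (a n'.+1) /\ Cr x (q n') (p n'.+1).
    by apply: ord; rewrite !ltnSn.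
  exists (a n'); split.
  - by right.
  - by move: xay' xaa xay; cycb x [:: a n'; a n'.+1; y].
  - move=> i; rewrite ltnS leq_eqVlt => /orP[/eqP ->|i_n'].
      by move: xay'; cycb x [:: y; a n'].
    have [xai _] : Cr x (a i) (a n') /\ Cr x (q i) (p n').
      by apply: ord; rewrite i_n' ltnW.
    by move: xay' xai; cycb x [:: y; a n'; a i].
have ly : proper_arc k l y by case: lx => [->//|]; exact: proper_arcr.
have lMy : Cr l M y.
  by case: lx => [->//|]; move: la aM xMy; cycb x [:: y; l; a n; M].
have [g1 g1ly lMg] := arc_push ly la lMy.
set c := g1 (a n) in lMg *.
have [xMc xcy] : Cr x M c /\ Cr x c y.
  have := rigid_stab_arc_stable ly g1ly la; rewrite -/c.
  move=> lcy; case: lx => [<-//|xly].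
  by split; move: lMg lcy xly; cycb x [:: y; l; M; c].
have g1a i : (i < n)%N -> g1 (a i) = a i.
  by move=> /lai i_n; apply: (rigid_stab_fix g1ly); apply/negP.
have xc := proper_arcl xy xcy.
have [||g2 g2xc g2a] := IH c xc.
- move=> i i_n; have [xaiy xpqi xqiy] := ends i (ltnW i_n).
  have [xai xqp] : Cr x (a i) (a n) /\ Cr x (q i) (p n).
    by apply: ord; rewrite i_n ltnSn.
  split=> //.
    by move: xai aM xMc; cycb x [:: a i; a n; M; c].
  by move: xqp xpq qM xMc; cycb x [:: q i; p n; q n; M; c].
- by move=> i j /andP[ij jn]; apply: ord; rewrite ij ltnW.
have [|||g3 g3py g3c] := @arc_pull x y c (p n) (q n) xy xcy.
- by right; move: xpq xqy; cycb x [:: p n; q n; y].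
- by move: xpq xqy; cycb x [:: p n; q n; y].
- by move: xpq qM xMc xcy; cycb x [:: p n; q n; M; c; y].
exists (g3 \o (g2 \o g1)).
  apply: rigid_stabM => //.
    apply: rigid_stabS g3py => z; move: xpq xqy; rewrite /open_arc /=.
    by cycb x [:: p n; q n; y; z].
  apply: rigid_stabM => //.
    apply: rigid_stabS g2xc => z; move: xcy; rewrite /open_arc /=.
    by cycb x [:: c; y; z].
  apply: rigid_stabS g1ly => z; rewrite /open_arc /=.
  by case: lx => [->//|]; cycb x [:: l; y; z].
move=> i; rewrite ltnS leq_eqVlt => /orP[/eqP ->|i_n] /=.
  by rewrite -/c (rigid_stab_fix g2xc) // /open_arc /=; apply/negP; cycb x [:: c].
(* The earlier images lie before [q i], hence before [p n], where [g3] acts trivially. *)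
have pgq := g2a i i_n; rewrite g1a // (rigid_stab_fix g3py) //.
have [_ xqp] : Cr x (a i) (a n) /\ Cr x (q i) (p n).
  by apply: ord; rewrite i_n ltnSn.
have [xaiy xpqi xqiy] := ends i (ltnW i_n).
rewrite /open_arc /=; apply/negP; move: pgq xpqi xqp xpq xqy.
by cycb x [:: y; p i; q i; g2 (a i); p n; q n].
Qed.

End LocallySweeping.

(** * Highly approximate transitivity on lines and circles *)

Section SweepingToTransitive.
Context {d : Order.disp_t} {L : orderType d} (k : kind) (G : set (L -> L)).
Context (HG : nearly_ordered_perm_group k G).
Context (proper0 : exists x y : L, proper_arc k x y).
Implicit Types (x y z u v w : L) (g h : L -> L).

Lemma gt_exists x : ~~ is_circ k -> exists y, x < y.
Proof.
case: HG => -[_ + _ _] => /[swap] /negPf -> ends; apply: contrapT => N.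
by apply: (ends x); right=> y; rewrite leNgt; apply/negP => xy; apply: N; exists y.
Qed.

Lemma lt_exists x : ~~ is_circ k -> exists y, y < x.
Proof.
case: HG => -[_ + _ _] => /[swap] /negPf -> ends; apply: contrapT => N.
by apply: (ends x); left=> y; rewrite leNgt; apply/negP => xy; apply: N; exists y.
Qed.

(** Keeping both ends inside [I] lets the order relations between target intervals pass to the ends
    of the chosen arcs. *)
Lemma open_interval_arc (I : set L) : open_interval k I ->
  exists p q, [/\ proper_arc k p q, I p, I q & open_arc p q `<=` I].
Proof.
have kL : nearly_ordered (L := L) k by have [] := HG.
case=> [/bounded_intervalE[x [y [xy ->]]]|].
  have [p xpy] := arc_nonempty kL xy.
  have [q pqy] := arc_nonempty kL (proper_arcr xy xpy).
  exists p, q; split=> //.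
  - exact: proper_arcl (proper_arcr xy xpy) pqy.
  - by move: xpy pqy; rewrite /open_arc /=; cycb x [:: p; q; y].
  - by move=> z; move: xpy pqy; rewrite /open_arc /=; cycb x [:: p; q; y; z].
have [x0 [y0 xy0]] := proper0; case: ifP => kc.
  case=> [->|[x ->]]; first by exists x0, y0.
  have [p px] : exists p, p != x.
    have [x0x|] := eqVneq x0 x; last by exists x0.
    by exists y0; move: xy0; rewrite /proper_arc kc x0x eq_sym.
  have kpx : proper_arc k p x by rewrite /proper_arc kc.
  have [q pqx] := arc_nonempty kL kpx; exists p, q; split=> //=.
  - exact: proper_arcl pqx.
  - by move: pqx; cycb p [:: q; x].
  - by move=> z; move: pqx; rewrite /open_arc /=; cycb p [:: q; x; z].
have k' : ~~ is_circ k by rewrite kc.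
have arcE p q : p < q -> proper_arc k p q by rewrite /proper_arc kc.
case=> [->|[x ->]|[x ->]]; first by exists x0, y0.
  have [p xp] := gt_exists x k'; have [q pq] := gt_exists p k'.
  exists p, q; split=> //=; first exact: arcE.
    exact: lt_trans pq.
  by move=> z; rewrite /open_arc /= CrE // => /andP[/(lt_trans xp)].
have [q qx] := lt_exists x k'; have [p pq] := lt_exists q k'.
exists p, q; split=> //=; first exact: arcE.
  exact: lt_trans qx.
by move=> z; rewrite /open_arc /= CrE // => /andP[_ /lt_trans]; apply.
Qed.

Lemma lt_seq_exists (s : seq L) : ~~ is_circ k ->
  exists x, forall z, z \in s -> x < z.
Proof.
move=> k'; elim: s => [|u s [x xs]]; first by have [x0 _] := proper0; exists x0.
have [v vxu] := lt_exists (Order.min x u) k'; exists v => z.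
by move: vxu; rewrite lt_min inE => /andP[vx vu] /orP[/eqP->//|/xs]; exact: lt_trans.
Qed.

Lemma gt_seq_exists (s : seq L) : ~~ is_circ k ->
  exists x, forall z, z \in s -> z < x.
Proof.
move=> k'; elim: s => [|u s [x xs]]; first by have [x0 _] := proper0; exists x0.
have [v vxu] := gt_exists (Order.max x u) k'; exists v => z.
move: vxu; rewrite gt_max inE => /andP[vx vu] /orP[/eqP->//|/xs zx].
exact: lt_trans vx.
Qed.

(** Opens the circle at [c]: [x] is taken just after [c] and [y] just before it, so that [s] lies
    between them. For empty [s] they may coincide. *)
Lemma Cr_seq_exists c (s : seq L) : is_circ k -> c \notin s ->
  exists x y, [/\ c != y, c != x & forall z, z \in s -> Cr c x z /\ Cr c z y].
Proof.
move=> kc; have kL : nearly_ordered (L := L) k by have [] := HG.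
elim: s => [_|u s IH].
  have [x0 [y0 xy0]] := proper0; move: xy0; rewrite /proper_arc kc.
  have [<-|cx0] := eqVneq c x0; first by exists y0, y0.
  by exists x0, x0.
rewrite inE negb_or => /andP[cu /IH [x [y [cy cx xys]]]].
have [x' [cx' x'u x'x]] : exists x', [/\ c != x', Cr c x' u & x' = x \/ Cr c x' x].
  have [cxu|ncxu] := boolP (Cr c x u); first by exists x; split=> //; left.
  have [x' cx'u] : exists x', Cr c x' u.
    by apply: (arc_nonempty kL); rewrite /proper_arc kc.
  by exists x'; split=> //; [|right]; move: cx'u ncxu cx cu; cycb c [:: x; x'; u].
have [y' [cy' uy' yy']] : exists y', [/\ c != y', Cr c u y' & y' = y \/ Cr c y y'].
  have [cuy|ncuy] := boolP (Cr c u y); first by exists y; split=> //; left.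
  have [y' uy'c] : exists y', Cr u y' c.
    by apply: (arc_nonempty kL); rewrite /proper_arc kc eq_sym.
  by exists y'; split; [| |right]; move: uy'c ncuy cy cu; cycb c [:: y; y'; u].
exists x', y'; split=> // z; rewrite inE => /orP[/eqP->//|/xys[cxz czy]]; split.
  by case: x'x => [->//|]; move: cxz; cycb c [:: x; x'; z].
by case: yy' => [->//|]; move: czy; cycb c [:: y; y'; z].
Qed.

Context (complete : dedekind_complete L k) (sweep : locally_sweeping k G).

Lemma sweeping_linear_transitive : ~~ is_circ k -> highly_approx_o_transitive k G.
Proof.
move=> k' [|n] a I; first by exists id => [|[]//]; case: HG => _ [].
rewrite /ordered_points /ordered_sets (negPf k') => a_lt I_int I_lt.
have [P] := choice (fun i => open_interval_arc (I_int i)).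
case/choice=> Q PQ.
have [x xs] := lt_seq_exists (codom a ++ codom P) k'.
have [y ys] := gt_seq_exists (x :: codom a ++ codom Q) k'.
have xy : x < y by apply: ys; rewrite mem_head.
have xa i : x < a i by apply: xs; rewrite mem_cat codom_f.
have xP i : x < P i by apply: xs; rewrite mem_cat codom_f orbT.
have ay i : a i < y by apply: ys; rewrite inE mem_cat codom_f orbT.
have Qy i : Q i < y by apply: ys; rewrite inE mem_cat codom_f !orbT.
have PltQ i : P i < Q i by have [] := PQ i; rewrite /proper_arc (negPf k').
have xyk : proper_arc k x y by rewrite /proper_arc (negPf k').
have Crx u v : x < u -> u < v -> Cr x u v by rewrite /Cr => -> ->.
(* Reindexes the families by [nat]; [inord] sends indices above [n] to [ord0]. *)
pose o i : 'I_n.+1 := inord i.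
have [||g [Gg _] gPQ] := arc_transitive HG complete sweep
  (n := n.+1) (a := a \o o) (p := P \o o) (q := Q \o o) xyk.
- move=> i _ /=; split; apply: Crx => //.
  exact: lt_trans (xP _) (PltQ _).
- move=> i j /andP[ij jn] /=; have oij : (o i < o j)%N.
    by rewrite !inordK // (ltn_trans ij).
  split; apply: Crx => //; first exact: a_lt.
    exact: lt_trans (xP _) (PltQ _).
  by have [_ _ IQ _] := PQ (o i); have [_ IP _ _] := PQ (o j); exact: I_lt IQ IP.
exists g => // i; have [_ _ _] := PQ i; apply; have := gPQ i (ltn_ord i).
by rewrite /= /o inord_val.
Qed.

Lemma sweeping_circular_move c p q : is_circ k -> p != q ->
  exists g, [/\ G g, forall u v w, Cr (g u) (g v) (g w) = Cr u v w & Cr p (g c) q].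
Proof.
move=> kc pq; have [kL [G1 _ _] _] := HG.
have [pcq|npcq] := boolP (Cr p c q); first by exists id.
have kpq : proper_arc k p q by rewrite /proper_arc kc.
have [r prq] := arc_nonempty kL kpq.
(* The arc from [r] to [r'] goes the long way round and contains everything outside the arc from [p]
   to [q]; inside it [c] can be pulled between [r] and [q]. *)
have [r' pr'r] := arc_nonempty kL (proper_arcl kpq prq).
have krr : proper_arc k r r'.
  by rewrite /proper_arc kc; move: pr'r; cycb p [:: r; r'].
have rcr : Cr r c r' by move: pr'r prq npcq; cycb p [:: r; r'; q; c].
have [|||g gr gc] := @arc_pull _ _ _ _ HG complete sweep r r' c r q krr rcr.
- by left.
- by move: prq pr'r; cycb p [:: r; r'; q].
- by [].
exists g; split; first by case: gr.
  exact: (rigid_stab_arc_Cr HG krr gr).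
by move: gc prq; cycb p [:: r; q; g c].
Qed.

Lemma sweeping_circular_transitive : is_circ k -> highly_approx_o_transitive k G.
Proof.
move=> kc [|n] a I; first by exists id => [|[]//]; case: HG => _ [].
rewrite /ordered_points /ordered_sets kc => -[a_ne a_Cr] I_int [I_dis I_Cr].
have [kL [G1 GM GV] _] := HG.
have [P] := choice (fun i => open_interval_arc (I_int i)).
case/choice=> Q PQ.
have PneQ i : P i != Q i by have [] := PQ i; rewrite /proper_arc kc.
have [g0 [Gg0 g0Cr g0a]] := sweeping_circular_move (a ord0) kc (PneQ ord0).
set c := g0 (a ord0) in g0a.
have Ic : I ord0 c by have [_ _ _] := PQ ord0; apply.
(* The shift by one skips index 0, whose point is already in place at [c]; the other [n] points are
   moved on an arc avoiding [c]. *)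
pose o i : 'I_n.+1 := inord i.+1.
have oE i : (i < n)%N -> (o i = i.+1 :> nat) by move=> i_n; rewrite inordK.
pose b i := g0 (a (o i)).
have g0_inj : injective g0 by have [g _ [/can_inj]] := GV _ Gg0.
pose s := [seq b i | i <- iota 0 n] ++ [seq P (o i) | i <- iota 0 n]
  ++ [seq Q (o i) | i <- iota 0 n].
have notI i : (i < n)%N -> ~ I (o i) c.
  move=> i_n Ii; have : (I ord0 `&` I (o i)) c by [].
  by rewrite I_dis //= oE.
have cs : c \notin s.
  rewrite !mem_cat !negb_or; apply/and3P; split; apply/mapP=> -[i];
    rewrite mem_iota add0n => /= i_n.
  - by move/g0_inj; apply: a_ne; rewrite /= oE.
  - by move=> cP; apply: (notI i i_n); rewrite cP; have [] := PQ (o i).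
  - by move=> cQ; apply: (notI i i_n); rewrite cQ; have [] := PQ (o i).
have [n0|n_gt0] := posnP n.
  exists g0 => // i; rewrite (_ : i = ord0) //; apply: val_inj => /=.
  by have := ltn_ord i; lia.
have [x [y [cy cx xys]]] := Cr_seq_exists kc cs.
have mem_n i : (i < n)%N -> i \in iota 0 n by rewrite mem_iota.
have xyb i : (i < n)%N -> Cr c x (b i) /\ Cr c (b i) y.
  by move=> i_n; apply: xys; rewrite !mem_cat map_f ?mem_n.
have xyP i : (i < n)%N -> Cr c x (P (o i)) /\ Cr c (P (o i)) y.
  by move=> i_n; apply: xys; rewrite !mem_cat (map_f (P \o o)) ?mem_n ?orbT.
have xyQ i : (i < n)%N -> Cr c x (Q (o i)) /\ Cr c (Q (o i)) y.
  by move=> i_n; apply: xys; rewrite !mem_cat (map_f (Q \o o)) ?mem_n ?orbT.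
have cxy : Cr c x y by have := xyb 0%N n_gt0; move=> []; cycb c [:: x; y; b 0%N].
have xyk : proper_arc k x y by rewrite /proper_arc kc; move: cxy; cycb c [:: x; y].
have [||g gxy gPQ] := arc_transitive HG complete sweep
  (n := n) (a := b) (p := P \o o) (q := Q \o o) xyk.
- move=> i i_n /=; have [xb byy] := xyb i i_n.
  have [xP Py] := xyP i i_n; have [xQ Qy] := xyQ i i_n.
  split.
  + by move: xb byy; cycb c [:: x; y; b i].
  (* The target arc misses [c], so its end [P (o i)] precedes [Q (o i)] as seen from [c]. *)
  + have : ~~ Cr (P (o i)) c (Q (o i)).
      by apply/negP => PcQ; apply: (notI i i_n); have [_ _ _] := PQ (o i); apply.
    by move: (PneQ (o i)) xP xQ; cycb c [:: x; P (o i); Q (o i)].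
  + by move: xQ Qy; cycb c [:: x; y; Q (o i)].
- move=> i j /andP[ij jn] /=; have i_n := ltn_trans ij jn.
  have oij : (o i < o j)%N by rewrite !oE.
  have o0i : (@ord0 n < o i)%N by rewrite /= oE.
  split.
    have : Cr c (b i) (b j) by rewrite g0Cr a_Cr.
    by move: (xyb i i_n) (xyb j jn) => [+ _] [+ _]; cycb c [:: x; b i; b j].
  have : Cr c (Q (o i)) (P (o j)).
    by have [_ _ IQ _] := PQ (o i); have [_ IP _ _] := PQ (o j); exact: I_Cr Ic IQ IP.
  by move: (xyQ i i_n) (xyP j jn) => [+ _] [+ _]; cycb c [:: x; Q (o i); P (o j)].
exists (g \o g0); first by case: gxy => Gg _; exact: GM.
move=> i /=; have [->|i0] := eqVneq i ord0.
  rewrite -/c (rigid_stab_fix gxy) // /open_arc /=; apply/negP.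
  by move: cxy; cycb c [:: x; y].
have i_gt0 : (0 < i)%N by rewrite lt0n.
have i_n : (i.-1 < n)%N by have := ltn_ord i; rewrite -{1}(prednK i_gt0) ltnS.
have io : i = o i.-1 by apply: val_inj; rewrite /= oE // prednK.
by rewrite io; have [_ _ _] := PQ (o i.-1); apply; exact: gPQ.
Qed.

End SweepingToTransitive.

(** * The stretching properties *)

Section TransitiveToStretching.
Context {d : Order.disp_t} {L : orderType d} (k : kind) (G : set (L -> L)).
Context (HG : nearly_ordered_perm_group k G).

Lemma transitive_upward : ~~ is_circ k ->
  highly_approx_o_transitive k G -> approx_2_upward_transitive k G.
Proof.
move=> k' trans a b c I ab bc I_int Ia.
(* The target of [a] is cut down to an interval below [a], which is disjoint from the ray above [c]
   even when [I] is unbounded. *)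
have [p pa pI] : exists2 p, p < a & forall z, p < z -> z < a -> I z.
  have [p0 p0a] := lt_exists HG a k'.
  move: I_int Ia; rewrite /open_interval /bounded_interval (negPf k').
  case=> [[x [y [_ ->]]] [xa ay]|[->|[x ->] xa|[y ->] ay]].
  - by exists x => // z xz /lt_trans/(_ ay).
  - by exists p0.
  - by exists x.
  - by exists p0 => // z _ /lt_trans/(_ ay).
pose aa (i : 'I_2) := if i == ord0 then a else b.
pose J (i : 'I_2) :=
  if i == ord0 then [set z | p < z /\ z < a] else [set z | c < z].
have ltE (i j : 'I_2) : (i < j)%N -> i = ord0 /\ (j == ord0) = false.
  by case: i j => [[|[|//]] ?] [[|[|//]] ?] //= _; split=> //; exact: val_inj.
have [|||g Gg gJ] := trans 2 aa J.
- by rewrite /ordered_points (negPf k') => i j /ltE[-> j0]; rewrite /aa j0 eqxx.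
- move=> i; rewrite /J /open_interval /bounded_interval (negPf k').
  by case: ifP => _; [left; exists p, a|right; constructor 2; exists c].
- rewrite /ordered_sets (negPf k') => i j /ltE[-> j0] x y.
  rewrite /J j0 eqxx => -[_ xa] /(lt_trans (lt_trans ab bc)).
  exact: lt_trans xa.
have [pga gaa] : p < g a /\ g a < a by have := gJ ord0; rewrite /J /aa eqxx.
have cgb : c < g b by have := gJ (lift ord0 ord0).
exists g; last by split=> //; exact: pI.
(* Since [g a < a < b < c < g b], the map cannot reverse the order. *)
split=> //; have [//|] := preserving_or_reversing HG Gg.
rewrite /reversing (negPf k') => rev; exfalso; have := rev b a.
by rewrite ab ltNge ltW // (lt_trans gaa) // (lt_trans ab) // (lt_trans bc).
Qed.

Lemma transitive_outward : is_circ k ->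
  highly_approx_o_transitive k G -> approx_3_outward_transitive k G.
Proof.
move=> kc trans a b c I _ bac I_int /bounded_intervalE[x [y [xy ->]]] IJ Ia.
have kL : nearly_ordered (L := L) k by have [] := HG.
have ne : x != y by move: xy; rewrite /proper_arc kc.
(* [m] splits the complement of the larger interval into two arcs, one as target for [b] and one for
   [c]. *)
have [m ymx] : exists m, Cr y m x.
  by apply: (arc_nonempty kL); rewrite /proper_arc kc eq_sym.
pose aa (i : 'I_3) := nth a [:: b; a; c] i.
pose J (i : 'I_3) := nth I [:: open_arc m x; I; open_arc y m] i.
have [|||g Gg gJ] := trans 3 aa J.
- rewrite /ordered_points kc; split.
    case=> [[|[|[|//]]] ?] [[|[|[|//]]] ?] //= _; rewrite /aa /=; apply/eqP;
      by move: bac; cycb b [:: a; c].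
  by case=> [[|[|[|//]]] ?] [[|[|[|//]]] ?] [[|[|[|//]]] ?].
- have arcs u v : Cr y m x -> u != v -> open_interval k (open_arc u v).
    by move=> _ uv; left; apply/bounded_intervalE; exists u, v; rewrite /proper_arc kc.
  case=> [[|[|[|//]]] ?]; rewrite /J /=; [|by left|]; apply: arcs => //.
    by move: ymx; cycb y [:: m; x].
  by move: ymx; cycb y [:: m; x].
- rewrite /ordered_sets kc; split.
    case=> [[|[|[|//]]] ?] [[|[|[|//]]] ?] //= _; rewrite /J /= -subset0 => z [].
    + by move=> mzx /IJ; move: ymx mzx; rewrite /open_arc /=; cycb y [:: m; x; z].
    + by move: ymx; rewrite /open_arc /=; cycb y [:: m; x; z].
    + by move=> /IJ; move: ymx; rewrite /open_arc /=; cycb y [:: m; x; z].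
  case=> [[|[|[|//]]] ?] [[|[|[|//]]] ?] [[|[|[|//]]] ?] //= _ _ u v w.
  rewrite /J /= => + /IJ; move: ymx; rewrite /open_arc /=.
  by cycb y [:: m; x; u; v; w].
exists g => //.
have := gJ (Ordinal (isT : (1 < 3)%N)); have := gJ (Ordinal (isT : (0 < 3)%N)).
have := gJ (Ordinal (isT : (2 < 3)%N)); rewrite /J /aa /open_arc /= => gc gb ga.
split=> //; apply/negP.
  by move: ymx gb; cycb y [:: m; x; g b].
by move: ymx gc; cycb y [:: m; x; g c].
Qed.

End TransitiveToStretching.

(** * From outward transitivity to local sweeping on circles *)

Section OutwardToSweeping.
Context {d : Order.disp_t} {L : orderType d} (k : kind) (G : set (L -> L)).
Context (HG : nearly_ordered_perm_group k G) (kc : is_circ k).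
Context (outward : approx_3_outward_transitive k G).

(** The arc from [x] to [y] lies on one side of [g b] and [g c], so its preimage lies on the side of
    [a], whether or not [g] reverses orientation. This confines the supports of conjugates. *)
Lemma Aut_Cr_spread (g : L -> L) x y a b c z : G g -> Cr b a c -> Cr x (g a) y ->
  ~~ Cr x (g b) y -> ~~ Cr x (g c) y -> Cr x (g z) y -> Cr b z c.
Proof.
move=> Gg bac xay xby xcy xzy; have := preserving_or_reversing HG Gg.
rewrite /preserving /reversing kc => -[gE|gE].
  by rewrite -gE; apply: (Cr_same_side xay xzy); rewrite ?gE.
by rewrite -gE; apply: (Cr_same_side xay xzy); rewrite ?gE.
Qed.

(** If [a] lies outside the target, some [g] stretches a small arc inside the target over a large
    arc containing [a]; the inverse of [g] then brings [a] in. *)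
Lemma outward_move a p q : p != q -> exists2 g, G g & Cr p (g a) q.
Proof.
move=> pq; have [kL [G1 _ GV] _] := HG.
have [paq|npaq] := boolP (Cr p a q); first by exists id.
have kpq : proper_arc k p q by rewrite /proper_arc kc.
have [m pmq] := arc_nonempty kL kpq.
have [m' pm'm] := arc_nonempty kL (proper_arcl kpq pmq).
have kmq := proper_arcr kpq pmq.
have [b' mbq] := arc_nonempty kL kmq.
have kbq := proper_arcr kmq mbq.
have [a' baq] := arc_nonempty kL kbq.
have [c' acq] := arc_nonempty kL (proper_arcr kbq baq).
have int (u v : L) : u != v -> bounded_interval k (open_arc u v).
  by move=> uv; apply/bounded_intervalE; exists u, v; rewrite /proper_arc kc.
have mm' : m != m' by move: pm'm; cycb p [:: m; m'].
have mq : m != q by move: kmq; rewrite /proper_arc kc.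
have bac : Cr b' a' c' by move: baq acq; cycb b' [:: a'; c'; q].
have maq : Cr m a' q by move: mbq baq; cycb m [:: a'; b'; q].
have sub : open_arc m q `<=` open_arc m m'.
  by move=> z; move: pmq pm'm; rewrite /open_arc /=; cycb p [:: m; m'; q; z].
have [g Gg [ga gb gc]] := outward bac (int _ _ mq) (int _ _ mm') sub maq.
have [g' Gg' [gK g'K]] := GV _ Gg; exists g' => //.
have : Cr b' (g' a) c'.
  apply: (Aut_Cr_spread Gg bac); [exact: sub| exact/negP | exact/negP |].
  by rewrite g'K; move: npaq pmq pm'm; cycb p [:: m; m'; q; a].
by move: pmq mbq baq acq; cycb p [:: m; q; a'; b'; c'; g' a].
Qed.

Context (Hbounded : exists2 g : L -> L, G g & g <> id /\ bounded_perm k g).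

Lemma outward_sweeping : locally_sweeping k G.
Proof.
have [kL [G1 GM GV] _] := HG.
case: Hbounded => h0 Gh0 [h0id [J /bounded_intervalE[x [y [xy ->]]] h0J]].
have [h [u [hxy xuh]]] : exists h u, rigid_stab G (open_arc x y) h /\ Cr x u (h u).
  have h0xy : rigid_stab G (open_arc x y) h0 by [].
  have [u h0u] : exists u, h0 u <> u.
    apply: contrapT => N; apply: h0id; apply: funext => u.
    by apply: contrapT => h0u; apply: N; exists u.
  have xuy : Cr x u y := h0J _ h0u.
  have xhuy := rigid_stab_arc_stable HG xy h0xy xuy.
  have [xuh|nxuh] := boolP (Cr x u (h0 u)); first by exists h0, u.
  have [h [hxy _ h0K]] := rigid_stabV GV h0xy; exists h, u; split=> //.
  rewrite -(rigid_stab_arc_mono HG _ _ xy h0xy) h0K.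
  by move/eqP: h0u nxuh xhuy xuy; cycb x [:: y; u; h0 u].
have [h' [h'xy hK h'K]] := rigid_stabV GV hxy.
have hmono := rigid_stab_arc_mono HG _ _ xy hxy.
(* A fixed point beyond [h' u] would, after applying [h], be beyond [u]; being before [h u], it
   would also be before [u]. *)
have moved v : Cr (h' u) v (h u) -> h v != v.
  move=> hvh; apply/eqP => hv; have xh'u : Cr x (h' u) u by rewrite -hmono h'K.
  have xh'v : Cr x (h' u) v by move: xh'u xuh hvh; cycb x [:: u; v; h u; h' u].
  have xuv : Cr x u v by rewrite -(h'K u) -hv hmono.
  have : Cr x v (h u) by move: xh'u xuh hvh; cycb x [:: u; v; h u; h' u].
  by rewrite -{1}hv hmono; move: xuv; cycb x [:: u; v].
have xuy : Cr x u y.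
  by apply: hxy.2 => hu; move: xuh; rewrite hu; cycb x [:: u].
have xhu := rigid_stab_arc_stable HG xy hxy xuy.
have xh'u := rigid_stab_arc_stable HG xy h'xy xuy.
have huu : Cr x (h' u) u by rewrite -hmono h'K.
move=> I a /bounded_intervalE[p [q [pq ->]]] paq.
have ne : h' u != h u by move: huu xuh; cycb x [:: u; h u; h' u].
have [g1 Gg1 g1a] := outward_move a ne.
have int (v w : L) : v != w -> bounded_interval k (open_arc v w).
  by move=> vw; apply/bounded_intervalE; exists v, w; rewrite /proper_arc kc.
have sub : open_arc (h' u) (h u) `<=` open_arc x y.
  move=> z; move: xhu xh'u huu xuh; rewrite /open_arc /=.
  by cycb x [:: y; u; h u; h' u; z].
(* [g2] keeps the image of [a] among points moved by [h] and drives the ends of the target arc off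
   the arc supporting [h]. *)
have [g2 Gg2 [g2a g2p g2q]] : exists2 g2, G g2 &
    [/\ open_arc (h' u) (h u) (g2 (g1 a)),
        ~ open_arc x y (g2 (g1 p)) & ~ open_arc x y (g2 (g1 q))].
  have xy' : x != y by move: xy; rewrite /proper_arc kc.
  have out b c bac := @outward (g1 a) b c _ _ bac (int _ _ ne) (int _ _ xy') sub g1a.
  (* If [g1] reverses orientation, [p] and [q] exchange roles. *)
  have : Cr (g1 p) (g1 a) (g1 q) \/ Cr (g1 q) (g1 a) (g1 p).
    have := preserving_or_reversing HG Gg1.
    by rewrite /preserving /reversing kc => -[gE|gE]; rewrite !gE; [left|right].
  by case=> /out[g2 Gg2 []]; exists g2.
pose g := g2 \o g1; have Gg : G g by exact: GM.
have [g' Gg' [gK g'K]] := GV _ Gg.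
have gJ := rigid_stabJ G1 GM Gg' Gg g'K gK hxy.
exists (g' \o h \o g); first by case: gJ.
split.
  move=> z /(gJ.2) xgz; apply: (Aut_Cr_spread Gg paq _ _ _ xgz).
  - exact: sub.
  - exact/negP.
  - exact/negP.
move=> /= /(congr1 g); rewrite /= g'K => /eqP.
by rewrite (negPf (moved _ g2a)).
Qed.

End OutwardToSweeping.

(** * From upward transitivity to local sweeping on lines *)

Section UpwardToSweeping.
Context {d : Order.disp_t} {L : orderType d} (k : kind) (G : set (L -> L)).
Context (HG : nearly_ordered_perm_group k G) (k' : ~~ is_circ k).
Context (complete : dedekind_complete L k) (upward : approx_2_upward_transitive k G).
Context (Hbounded : exists2 g : L -> L, G g & g <> id /\ bounded_perm k g).
Implicit Types (x y z u v w p q s t : L) (g h : L -> L).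

Local Notation H := (Opp k G).

Lemma Opp_lt g x y : H g -> (g x < g y) = (x < y).
Proof. by case=> _; rewrite /preserving (negPf k'); apply. Qed.

Lemma Opp_le g x y : H g -> (g x <= g y) = (x <= y).
Proof. by move=> Hg; rewrite !leNgt Opp_lt. Qed.

Lemma Opp1 : H id.
Proof. by have [_ [G1 _ _] _] := HG; split=> //; rewrite /preserving (negPf k'). Qed.

Lemma OppM f g : H f -> H g -> H (f \o g).
Proof.
move=> Hf Hg; have [_ [_ GM _] _] := HG; split; first exact: GM Hf.1 Hg.1.
by rewrite /preserving (negPf k') => x y /=; rewrite !Opp_lt.
Qed.

Lemma OppV f : H f -> exists2 g, H g & cancel f g /\ cancel g f.
Proof.
move=> Hf; have [_ [_ _ GV] _] := HG; have [g Gg [fK gK]] := GV _ Hf.1.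
exists g => //; split=> //; rewrite /preserving (negPf k') => x y.
by rewrite -(Opp_lt _ _ Hf) !gK.
Qed.

Lemma glb_exists (S : set L) : S !=set0 -> lbound S !=set0 ->
  exists2 s, lbound S s & forall u, lbound S u -> u <= s.
Proof.
move=> [a Sa] S0; have [|s sub smin] := lub_exists complete S0.
  by exists a => u; apply.
by exists s => // z Sz; apply: smin => u; apply.
Qed.

(** An order-preserving bijection fixing [S] pointwise permutes the upper bounds of [S], hence fixes
    the least one. *)
Lemma fix_lub g (S : set L) s : H g -> (forall v, S v -> g v = v) ->
  ubound S s -> (forall u, ubound S u -> s <= u) -> g s = s.
Proof.
move=> Hg gS sub smin; have [g' Hg' [gK g'K]] := OppV Hg.
apply/eqP; rewrite eq_le; apply/andP; split; last first.
  by apply: smin => v Sv; rewrite -(gS v Sv) Opp_le //; exact: sub.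
rewrite -(Opp_le _ _ Hg') gK; apply: smin => v Sv.
by rewrite -(Opp_le _ _ Hg) g'K gS //; exact: sub.
Qed.

Lemma fix_glb g (S : set L) s : H g -> (forall v, S v -> g v = v) ->
  lbound S s -> (forall u, lbound S u -> u <= s) -> g s = s.
Proof.
move=> Hg gS slb smax; have [g' Hg' [gK g'K]] := OppV Hg.
apply/eqP; rewrite eq_le; apply/andP; split.
  by apply: smax => v Sv; rewrite -(gS v Sv) Opp_le //; exact: slb.
rewrite -(Opp_le _ _ Hg') gK; apply: smax => v Sv.
by rewrite -(Opp_le _ _ Hg) g'K gS //; exact: slb.
Qed.

(** First [h] moves [a] above [q]; then [g] stretches a subinterval of [(p, q)] over [h a], and its
    inverse brings [h a] into [(p, q)]. *)
Lemma upward_orbit_meets a p q : p < q -> exists2 g, H g & p < g a < q.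
Proof.
move=> pq; have [[dense _] _ _] := HG.
have [a0 a0a] := lt_exists HG a k'.
have [c0 c0aq] := gt_exists HG (Order.max a q) k'.
move: c0aq; rewrite gt_max => /andP[ac0 qc0].
have [|h Hh [_ hac]] := upward a0a ac0 (I := setT) _ I.
  by right; rewrite (negPf k'); constructor 1.
have [p1 [pp1 p1q]] := dense _ _ pq; have [p2 [p12 p2q]] := dense _ _ p1q.
have p2ha : p2 < h a by rewrite (lt_trans p2q) // (lt_trans qc0).
have [||g Hg [[pg gq] hag]] := upward p12 p2ha (I := [set z | p < z /\ z < q]).
- by left; rewrite /bounded_interval (negPf k'); exists p, q.
- by [].
have [g' Hg' [gK g'K]] := OppV Hg.
exists (g' \o h); first exact: OppM.
have p1g : p1 < g' (h a).
  by rewrite -(Opp_lt _ _ Hg) g'K (lt_trans gq) // (lt_trans qc0).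
have gp2 : g' (h a) < p2 by rewrite -(Opp_lt _ _ Hg) g'K.
by rewrite /= (lt_trans pp1) // (lt_trans gp2).
Qed.

(** Once [g] has put [s] into [(p, q)], upward transitivity keeps its image there while sending
    [g t] beyond [c]. *)
Lemma upward_stretch s t p q c : s < t -> p < q ->
  exists2 f, H f & p < f s < q /\ c < f t.
Proof.
move=> st pq; have [g Hg pgq] := upward_orbit_meets s pq.
have [c' c'm] := gt_exists HG (Order.max c (g t)) k'.
move: c'm; rewrite gt_max => /andP[cc' gtc'].
have gst : g s < g t by rewrite Opp_lt.
have [||f Hf [[pf fq] c'f]] := upward gst gtc' (I := [set z | p < z /\ z < q]).
- by left; rewrite /bounded_interval (negPf k'); exists p, q.
- by case/andP: pgq.
exists (f \o g); first exact: OppM.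
by rewrite /= pf fq (lt_trans cc').
Qed.

Definition itv x y : set L := [set z | x < z /\ z < y].

Lemma Opp_stabJ x y g g' h : H g -> H g' -> cancel g g' -> cancel g' g ->
  rigid_stab H (itv (g x) (g y)) h -> rigid_stab H (itv x y) (g' \o h \o g).
Proof.
move=> Hg Hg' gK g'K hxy.
apply: rigid_stabS (rigid_stabJ Opp1 OppM Hg' Hg g'K gK hxy) => z /=.
by rewrite /itv /= !Opp_lt.
Qed.

Lemma bounded_Opp : exists x y h u, rigid_stab H (itv x y) h /\ h u <> u.
Proof.
case: Hbounded => h Gh [hid [J /bounded_intervalE[x [y [xy ->]]] hJ]].
have hxy : rigid_stab G (open_arc x y) h by [].
have [u hu] : exists u, h u <> u.
  apply: contrapT => N; apply: hid; apply: funext => u.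
  by apply: contrapT => hu; apply: N; exists u.
exists x, y, h, u; split=> //; split.
  by split=> //; exact: rigid_stab_arc_preserving HG _ _ _ xy hxy.
move=> z /hJ; rewrite /open_arc /= CrE; first by case/andP.
by move: xy; rewrite /proper_arc (negPf k').
Qed.

(** [s] is the supremum of the fixed points below a moved point [u]; by [fix_lub] it is fixed
    too. *)
Lemma bounded_Opp_fix : exists s u h,
  [/\ H h, h s = s & forall v, s < v -> v <= u -> h v <> v] /\ s < u.
Proof.
have [x [y [h [u [hxy hu]]]]] := bounded_Opp.
have Hh := hxy.1; have [xu _] : itv x y u by exact: hxy.2.
have hx : h x = x by apply: (rigid_stab_fix hxy) => -[]; rewrite ltxx.
have [||s sub smin] := lub_exists complete (S := [set v | h v = v /\ v <= u]).
- by exists x; split=> //; exact: ltW.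
- by exists u => v [].
have hs : h s = s by apply: fix_lub sub smin => // v [].
have su : s <= u by apply: smin => v [].
exists s, u, h; split; last first.
  by rewrite lt_neqAle su andbT; apply/eqP => su'; apply: hu; rewrite -su'.
split=> // v sv vu hv; have : v <= s by exact: sub.
by rewrite leNgt sv.
Qed.

(** [f] stretches [(p, q)] over an interval supporting [h]; conjugating back by [f] puts the support
    inside [(p, q)]. *)
Lemma small_support p q : p < q -> exists h u, rigid_stab H (itv p q) h /\ h u <> u.
Proof.
move=> pq; have [x [y [h [u [hxy hu]]]]] := bounded_Opp.
have [x' x'x] := lt_exists HG x k'.
have [f Hf [/andP[_ fpx] yfq]] := upward_stretch y pq x'x.
have [f' Hf' [fK f'K]] := OppV Hf.
exists (f' \o h \o f), (f' u); split; last by move=> /= /(congr1 f); rewrite !f'K.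
apply: Opp_stabJ => //; apply: rigid_stabS hxy => z [xz zy].
by split; [exact: lt_trans xz|exact: lt_trans yfq].
Qed.

Definition stuck z w := z < w /\ forall y g, rigid_stab H (itv z y) g -> g w = w.

Lemma stuck_mono z z' w : z <= z' -> z' < w -> stuck z w -> stuck z' w.
Proof.
move=> zz' z'w [_ zwP]; split=> // y g gz'; apply: (zwP y).
by apply: rigid_stabS gz' => v [z'v vy]; split=> //; exact: le_lt_trans z'v.
Qed.

Lemma stuckJ g z w : H g -> stuck z w -> stuck (g z) (g w).
Proof.
move=> Hg [zw zwP]; have [g' Hg' [gK g'K]] := OppV Hg.
split=> [|y h hzy]; first by rewrite Opp_lt.
apply: (can_inj g'K); rewrite gK; apply: (zwP (g' y) (g' \o h \o g)).
by apply: Opp_stabJ => //; rewrite g'K.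
Qed.

Lemma not_stuck z w : ~ stuck z w.
Proof.
move=> zw; have [s [u [h [[Hh hs hfix] su]]]] := bounded_Opp_fix.
(* [f] puts [s] between [z] and [w] and [u] above [w], so the conjugate of [h] fixes [f s] and moves
   [w]. *)
have [f Hf [/andP[zs' s'w] wfu]] := upward_stretch w su zw.1.
have [f' Hf' [fK f'K]] := OppV Hf.
set s' := f s in zs' s'w.
have s'w_stuck : stuck s' w by apply: stuck_mono zw; [exact: ltW|].
have Hh1 : H (f \o h \o f') by do 2?[apply: OppM => //].
set h1 := f \o h \o f' in Hh1.
have h1s : h1 s' = s' by rewrite /h1 /s' /= fK hs.
have h1w : h1 w != w.
  apply/eqP => /(congr1 f'); rewrite /h1 /= fK; apply: hfix.
    by rewrite -(Opp_lt _ _ Hf) f'K.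
  by rewrite -(Opp_le _ _ Hf) f'K ltW.
have s'h1w_stuck : stuck s' (h1 w) by rewrite -h1s; exact: stuckJ.
have [w1 [w2 [w12 w1s w2s]]] : exists w1 w2, [/\ w1 < w2, stuck s' w1 & stuck s' w2].
  have [lt|gt|E] := ltgtP (h1 w) w; first by exists (h1 w), w.
    by exists w, (h1 w).
  by rewrite E eqxx in h1w.
have [g [v [gw12 gv]]] := small_support w12.
have [w1v vw2] : itv w1 w2 v by exact: gw12.2.
(* The element moving [v] is supported between [w1] and [w2], hence above [s']. *)
have vN : ~ stuck s' v.
  move=> [_ /(_ w2 g)] vP; apply: gv; apply: vP.
  by apply: rigid_stabS gw12 => r [w1r rw2]; split=> //; exact: lt_trans w1s.1 w1r.
(* [sg] and [ta] are the nearest stuck points on either side of [v]; limits of stuck points are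
   stuck by [fix_lub] and [fix_glb]. *)
have [||sg sg_ub sg_min] := lub_exists complete (S := [set r | stuck s' r /\ r <= v]).
- by exists w1; split=> //; exact: ltW.
- by exists v => r [].
have [||ta ta_lb ta_max] := glb_exists (S := [set r | stuck s' r /\ v <= r]).
- by exists w2; split=> //; exact: ltW.
- by exists v => r [].
have s'sg : s' < sg.
  by apply: lt_le_trans w1s.1 _; apply: sg_ub; split=> //; exact: ltW.
have sgv : sg <= v by apply: sg_min => r [].
have vta : v <= ta by apply: ta_max => r [].
have sg_stuck : stuck s' sg.
  split=> // y r ry; apply: fix_lub sg_ub sg_min; first exact: ry.1.
  by move=> o [[_ oP] _]; exact: oP ry.
have ta_stuck : stuck s' ta.
  split=> [|y r ry]; first by apply: lt_le_trans vta; apply: lt_trans w1v; exact: w1s.1.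
  by apply: fix_glb ta_lb ta_max; [exact: ry.1|move=> o [[_ oP] _]; exact: oP ry].
have gap r : sg < r -> r < ta -> ~ stuck s' r.
  move=> sgr rta rs; have [rv|vr] := leP r v.
    by have := sg_ub r (conj rs rv); rewrite leNgt sgr.
  by have := ta_lb r (conj rs (ltW vr)); rewrite leNgt rta.
have sgta : sg < ta.
  rewrite lt_neqAle (le_trans sgv) // andbT; apply/eqP => E; apply: vN.
  by have -> : v = sg by apply/eqP; rewrite eq_le sgv E vta.
have [e He [/andP[sge eta] tae]] := upward_stretch ta sgta sgta.
have [e' He' [eK e'K]] := OppV He.
(* In the first case [e sg] is stuck over [s'] and lies in the gap; in the second [ta] is stuck over
   [e s'], so [e' ta] is stuck over [s'] and lies in the gap. *)
have [es's'|s'es'] := leP (e s') s'.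
  apply: (gap (e sg)) => //; apply: stuck_mono (stuckJ He sg_stuck) => //.
  exact: lt_trans sge.
have : stuck s' (e' ta).
  rewrite -[s']eK; apply: stuckJ => //; apply: stuck_mono ta_stuck; first exact: ltW.
  by apply: lt_trans eta; rewrite Opp_lt.
by apply: gap; rewrite -(Opp_lt _ _ He) e'K.
Qed.

Lemma move_up z w : z < w -> exists y g, rigid_stab H (itv z y) g /\ w < g w.
Proof.
move=> zw; have [y [g [gzy gw]]] : exists y g, rigid_stab H (itv z y) g /\ g w <> w.
  apply: contrapT => N; apply: (@not_stuck z w); split=> // y g gzy.
  by apply: contrapT => gw; apply: N; exists y, g.
have [lt|gt|E] := ltgtP w (g w); first by exists y, g.
  have [g' [g'zy gK g'K]] := rigid_stabV OppV gzy; exists y, g'; split=> //.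
  by rewrite -(Opp_lt _ _ gzy.1) g'K.
by rewrite -E in gw.
Qed.

Lemma upward_sweeping : locally_sweeping k G.
Proof.
move=> I b; rewrite /bounded_interval (negPf k') => -[p [q [pq ->]]] [pb bq].
apply: contrapT => N.
pose S := [set r | b < r /\ forall g, rigid_stab H (itv p r) g -> g b = b].
have Sq : S q.
  split=> // g gpq; apply: contrapT => gb; apply: N; exists g; first exact: gpq.1.1.
  by split=> //; exact: gpq.2.
(* The element [h] moves [b], so no member of [S] exceeds [y]. *)
have [y [h [hpy hb]]] := move_up pb.
have [||Q Qub Qmin] := lub_exists complete (S := S); first by exists q.
  exists y => r [br rP]; rewrite leNgt; apply/negP => yr.
  have hE : h b = b.
    by apply: rP; apply: rigid_stabS hpy => v [pv vy]; split=> //; exact: lt_trans yr.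
  by rewrite hE ltxx in hb.
have bQ : b < Q by apply: lt_le_trans bq _; exact: Qub.
(* [g] fixes [p] and [b], so it maps [S] into itself although it raises the supremum [Q]. *)
have [y' [g [gby Qg]]] := move_up bQ.
have [g' [g'by gK g'K]] := rigid_stabV OppV gby.
have Hg := gby.1; have Hg' := g'by.1.
(* [r] is close enough to [Q] for [g r] to exceed [Q]. *)
have [r Sr gr] : exists2 r, S r & g' Q < r.
  apply: contrapT => Nr; have : Q <= g' Q.
    by apply: Qmin => r Sr; rewrite leNgt; apply/negP => gr; apply: Nr; exists r.
  by rewrite leNgt -(Opp_lt _ _ Hg) g'K Qg.
have Qgr : Q < g r by rewrite -(Opp_lt _ _ Hg') gK.
suff /Qub : S (g r) by rewrite leNgt Qgr.
split=> [|h' h'p]; first exact: lt_trans Qgr.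
have gp : g p = p.
  by apply: (rigid_stab_fix gby) => -[/(lt_trans pb)]; rewrite ltxx.
have gb : g b = b by apply: (rigid_stab_fix gby) => -[]; rewrite ltxx.
have := Sr.2 (g' \o h' \o g); rewrite /= gb => E; apply: (can_inj g'K).
rewrite E; first by rewrite -[in RHS]gb gK.
by apply: Opp_stabJ => //; rewrite gp.
Qed.

End UpwardToSweeping.

Theorem theorem12p14 (d : Order.disp_t) (L : orderType d) (k : kind)
    (G : set (L -> L))
    (HG : nearly_ordered_perm_group k G)
    (Hbounded : exists2 g : L -> L, G g & g <> id /\ bounded_perm k g)
    (Hcomplete : dedekind_complete L k) :
  (highly_approx_o_transitive k G <->
     (if is_circ k then approx_3_outward_transitive k G
      else approx_2_upward_transitive k G)) /\
  ((if is_circ k then approx_3_outward_transitive k G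
    else approx_2_upward_transitive k G) <->
     locally_sweeping k G).
Proof.
(* A proper arc serves as starting point for finding arcs inside unbounded intervals. *)
have proper0 : exists x y : L, proper_arc k x y.
  have [g _ [_ [J /bounded_intervalE[x [y [xy _]]] _]]] := Hbounded.
  by exists x, y.
have [kc|k'] := boolP (is_circ k).
  have t2s := transitive_outward HG kc.
  have s2l := outward_sweeping HG kc ^~ Hbounded.
  have l2t := sweeping_circular_transitive HG proper0 Hcomplete ^~ kc.
  by split; split; auto.
have t2s := transitive_upward HG k'.
have s2l := upward_sweeping HG k' Hcomplete ^~ Hbounded.
have l2t := sweeping_linear_transitive HG proper0 Hcomplete ^~ k'.
by split; split; auto.
Qed.
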